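(* Up to isomorphism, the only finite doubly distributive hyperfields are the Krasner hyperfield, the sign hyperfield and the finite fields.
   Context: A hyperoperation on a set $S$ is a map $\boxplus$ from $S\times S$ to the nonempty subsets of $S$; for nonempty $A,B\subseteq S$ put $A\boxplus B=\bigcup_{a\in A,b\in B}a\boxplus b$; $\boxplus$ is associative if $a\boxplus(b\boxplus c)=(a\boxplus b)\boxplus c$ for all $a,b,c$. A hypergroup is $(G,\boxplus,0)$ with $\boxplus$ an associative hyperoperation such that: $0\boxplus x=x\boxplus 0=\{x\}$ for all $x$; for every $x$ there is a unique $x'$ with $0\in x\boxplus x'$ and a unique $x''$ with $0\in x''\boxplus x$, and $x'=x''$, denoted $-x$; and $x\in y\boxplus z$ if and only if $-x\in -z\boxplus -y$. It is commutative if $y\boxplus z=z\boxplus y$ for all $y,z$. A hyperfield is $(R,\odot,\boxplus,1,0)$ with $(R,\odot,1)$ a commutative monoid, $(R,\boxplus,0)$ a commutative hypergroup, $x\odot 0=0$, $a\odot(x\boxplus y)=(a\odot x)\boxplus(a\odot y)$, $0\neq 1$, and every nonzero element having a multiplicative inverse. It is doubly distributive if $(a\boxplus b)(c\boxplus d)=ac\boxplus ad\boxplus bc\boxplus bd$ for all $a,b,c,d$ (products of sets being taken elementwise). A field is regarded as a hyperfield with $a\boxplus b=\{a+b\}$. The Krasner hyperfield is $\mathbb{K}=\{0,1\}$ with usual multiplication, $0\boxplus x=x\boxplus 0=\{x\}$ and $1\boxplus1=\{0,1\}$. The sign hyperfield is $\mathbb{S}=\{0,1,-1\}$ with usual multiplication,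 $0\boxplus x=x\boxplus 0=\{x\}$, $x\boxplus x=\{x\}$, $1\boxplus-1=-1\boxplus 1=\{0,1,-1\}$. Isomorphisms are bijections preserving $0$, $1$, multiplication and hyperaddition. *)

(* Defs.v *)
From mathcomp Require Import all_boot all_algebra.
From mathcomp Require Import boolp classical_sets cardinality.

Set Implicit Arguments.
Unset Strict Implicit.
Unset Printing Implicit Defensive.

Import GRing.Theory.
Local Open Scope classical_set_scope.

(* The extension of a hyperoperation to subsets. *)
Definition setop {T : Type} (op : T -> T -> set T) (A B : set T) : set T :=
  \bigcup_(a in A) \bigcup_(b in B) op a b.

(* The two "hopp" axioms say that [opp x] is the unique x' with 0 in x + x' and
   also the unique x'' with 0 in x'' + x; so [opp] is determined by the rest. *)
Record is_hypergroup (G : Type) (add : G -> G -> set G) (zero : G)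
    (opp : G -> G) : Prop := IsHypergroup {
  hadd_nonempty : forall x y, add x y !=set0;
  haddA : forall a b c,
    setop add [set a] (add b c) = setop add (add a b) [set c];
  hadd0l : forall x, add zero x = [set x];
  hadd0r : forall x, add x zero = [set x];
  hopp_r : forall x x', add x x' zero <-> x' = opp x;
  hopp_l : forall x x'', add x'' x zero <-> x'' = opp x;
  hadd_rev : forall x y z, add y z x <-> add (opp z) (opp y) (opp x)
}.

Record is_hyperfield (R : Type) (mul : R -> R -> R) (add : R -> R -> set R)
    (one zero : R) (opp : R -> R) : Prop := IsHyperfield {
  hf_mulA : associative mul;
  hf_mulC : commutative mul;
  hf_mul1 : left_id one mul;
  hf_hypergroup : is_hypergroup add zero opp;
  hf_addC : forall y z, add y z = add z y;
  hf_mul0 : forall x, mul x zero = zero;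
  hf_mulD : forall a x y,
    [set mul a z | z in add x y] = add (mul a x) (mul a y);
  hf_neq01 : zero <> one;
  hf_inv : forall x, x <> zero -> exists y, mul x y = one
}.

Record hyperfield := Hyperfield {
  hf_sort :> Type;
  hmul : hf_sort -> hf_sort -> hf_sort;
  hadd : hf_sort -> hf_sort -> set hf_sort;
  hone : hf_sort;
  hzero : hf_sort;
  hopp : hf_sort -> hf_sort;
  hyperfieldP : is_hyperfield hmul hadd hone hzero hopp
}.

Arguments hone {h}.
Arguments hzero {h}.

Definition doubly_distributive (R : hyperfield) : Prop :=
  forall a b c d : R,
    [set hmul x y | x in hadd a b & y in hadd c d] =
    setop (@hadd R)
      (setop (@hadd R) (hadd (hmul a c) (hmul a d)) [set hmul b c])
      [set hmul b d].

Definition hf_isomorphic (R R' : hyperfield) : Prop :=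
  exists f : R -> R',
    [/\ bijective f,
        f hzero = hzero,
        f hone = hone,
        forall x y, f (hmul x y) = hmul (f x) (f y) &
        forall x y, f @` (hadd x y) = hadd (f x) (f y)].

Lemma setop1l (T : Type) (op : T -> T -> set T) a B z :
  setop op [set a] B z <-> exists2 u, B u & op a u z.
Proof.
rewrite /setop bigcup_set1; split=> [[u Bu az]|[u Bu az]]; by exists u.
Qed.

Lemma setop1r (T : Type) (op : T -> T -> set T) A c z :
  setop op A [set c] z <-> exists2 u, A u & op u c z.
Proof.
split=> [[u Au]|[u Au uz]]; first by rewrite bigcup_set1 => uz; exists u.
by exists u => //; rewrite bigcup_set1.
Qed.

Lemma setop11 (T : Type) (op : T -> T -> set T) a b :
  setop op [set a] [set b] = op a b.
Proof. by rewrite /setop !bigcup_set1. Qed.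

Section FieldHyperfield.
Variable F : fieldType.
Local Open Scope ring_scope.

Definition field_add (x y : F) : set F := [set x + y].

Lemma field_hyperfieldP :
  is_hyperfield (fun x y : F => x * y) field_add 1 0 (fun x => - x).
Proof.
split; [exact: mulrA | exact: mulrC | exact: mul1r | | | exact: mulr0 | | |].
- split; rewrite /field_add.
  + by move=> x y; exists (x + y).
  + by move=> a b c; rewrite !setop11 addrA.
  + by move=> x; rewrite add0r.
  + by move=> x; rewrite addr0.
  + move=> x y; split=> /= [/esym/eqP|->]; last by rewrite subrr.
    by rewrite addrC addr_eq0 => /eqP.
  + move=> x y; split=> /= [/esym/eqP|->]; last by rewrite addNr.
    by rewrite addr_eq0 => /eqP.
  + move=> x y z; rewrite /= -opprD [z + y]addrC.
    by split=> [->//|/oppr_inj].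
- by move=> x y; rewrite /field_add addrC.
- by move=> a x y; rewrite /field_add image_set1 mulrDr.
- by move/eqP; rewrite eq_sym oner_eq0.
- by move=> x /eqP x0; exists x^-1; rewrite divff.
Qed.

Definition field_hyperfield : hyperfield := Hyperfield field_hyperfieldP.

End FieldHyperfield.

(* {0, 1} is [bool]; the usual multiplication is conjunction. *)
Definition krasner_add (x y : bool) : set bool :=
  match x, y with
  | false, _ => [set y]
  | _, false => [set x]
  | true, true => [set: bool]
  end.

Lemma krasner_addP (x y z : bool) :
  krasner_add x y z <-> [|| x && y, ~~ x && (z == y) | ~~ y && (z == x)].
Proof. by case: x y z => [] [] []. Qed.

Lemma krasner_add_nonempty x y : krasner_add x y !=set0.
Proof. by exists (x || y); case: x y => [] []. Qed.

Lemma krasner_hyperfieldP : is_hyperfield andb krasner_add true false id.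
Proof.
split; [exact: andbA | exact: andbC | exact: andTb | | | exact: andbF | | |].
- split.
  + exact: krasner_add_nonempty.
  + move=> a b c; apply/predeqP => z; rewrite setop1l setop1r.
    have ex_bool (P : bool -> bool) : (exists u, P u) <-> P true || P false.
      split=> [[[] ->]|/orP[]]; rewrite ?orbT //; by [exists true|exists false].
    transitivity (exists u, [|| b && c, ~~ b && (u == c) | ~~ c && (u == b)] &&
                            [|| a && u, ~~ a && (z == u) | ~~ u && (z == a)]).
      split=> [[u /krasner_addP + /krasner_addP]|[u /andP[]]].
        by move=> h k; exists u; rewrite h.
      by move=> h k; exists u; apply/krasner_addP.
    transitivity (exists u, [|| a && b, ~~ a && (u == b) | ~~ b && (u == a)] &&
                            [|| u && c, ~~ u && (z == c) | ~~ c && (z == u)]).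
      rewrite !ex_bool; by case: a b c z => [] [] [] [].
    split=> [[u /andP[]]|[u /krasner_addP + /krasner_addP]].
      by move=> h k; exists u; apply/krasner_addP.
    by move=> h k; exists u; rewrite h.
  + by [].
  + by case.
  + by case=> [] [].
  + by case=> [] [].
  + by move=> x y z; rewrite !krasner_addP; case: x y z => [] [] [].
- by case=> [] [].
- case=> x y.
    by rewrite image_id.
  apply/predeqP => z; split=> [[u _ <-//]|/= ->].
  by have [u xyu] := krasner_add_nonempty x y; exists u.
- by [].
- by case=> // _; exists true.
Qed.

Definition krasner : hyperfield := Hyperfield krasner_hyperfieldP.

Variant sign := SZero | SPos | SNeg.

Definition sign_opp (x : sign) : sign :=
  match x with SZero => SZero | SPos => SNeg | SNeg => SPos end.

Definition sign_mul (x y : sign) : sign :=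
  match x with SZero => SZero | SPos => y | SNeg => sign_opp y end.

Definition sign_add (x y : sign) : set sign :=
  match x, y with
  | SZero, _ => [set y]
  | _, SZero => [set x]
  | SPos, SPos => [set SPos]
  | SNeg, SNeg => [set SNeg]
  | SPos, SNeg | SNeg, SPos => [set: sign]
  end.

Definition sign_addb (x y z : sign) : bool :=
  match x, y, z with
  | SZero, SZero, SZero | SZero, SPos, SPos | SZero, SNeg, SNeg
  | SPos, SZero, SPos | SNeg, SZero, SNeg
  | SPos, SPos, SPos | SNeg, SNeg, SNeg
  | SPos, SNeg, _ | SNeg, SPos, _ => true
  | _, _, _ => false
  end.

Lemma sign_addP x y z : sign_add x y z <-> sign_addb x y z.
Proof. by case: x y z => [] [] []. Qed.

Lemma sign_add_nonempty x y : sign_add x y !=set0.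
Proof. by exists (if x is SZero then y else x); case: x y => [] []. Qed.

Lemma ex_sign (P : sign -> bool) :
  (exists u, P u) <-> [|| P SZero, P SPos | P SNeg].
Proof.
split=> [[[] ->]|/or3P[]]; rewrite ?orbT //;
  by [exists SZero | exists SPos | exists SNeg].
Qed.

Lemma sign_hyperfieldP :
  is_hyperfield sign_mul sign_add SPos SZero sign_opp.
Proof.
split; [by case=> [] [] [] | by case=> [] [] | by case | | | by case | | by [] |].
- split.
  + exact: sign_add_nonempty.
  + move=> a b c; apply/predeqP => z; rewrite setop1l setop1r.
    transitivity (exists u, sign_addb b c u && sign_addb a u z).
      split=> [[u /sign_addP + /sign_addP]|[u /andP[]]].
        by move=> h k; exists u; rewrite h.
      by move=> h k; exists u; apply/sign_addP.
    transitivity (exists u, sign_addb a b u && sign_addb u c z).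
      by rewrite !ex_sign; case: a b c z => [] [] [] [].
    split=> [[u /andP[]]|[u /sign_addP + /sign_addP]].
      by move=> h k; exists u; apply/sign_addP.
    by move=> h k; exists u; rewrite h.
  + by [].
  + by case.
  + by case=> [] [].
  + by case=> [] [].
  + by move=> x y z; rewrite !sign_addP; case: x y z => [] [] [].
- by case=> [] [].
- have oppK : involutive sign_opp by case.
  case=> x y; apply/predeqP => z.
  + split=> [[u _ <-//]|/= ->].
    by have [u xyu] := sign_add_nonempty x y; exists u.
  + by rewrite image_id.
  + rewrite sign_addP; split=> [[u /sign_addP + <-]|xyz].
      by case: x y u => [] [] [].
    exists (sign_opp z); last exact: oppK.
    by apply/sign_addP; case: x y z xyz => [] [] [].
- by case=> // _; [exists SPos | exists SNeg].
Qed.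

Definition sign_hyperfield : hyperfield := Hyperfield sign_hyperfieldP.

(* Main.v *)
(** Evaluating (q - p)(c + d) for distinct p, q in c + d shows that double
    distributivity forces c + d to be a singleton whenever d <> -c.  If 1 - 1
    is {0}, all sums are singletons and R is a field.  Otherwise consider the
    t with 1 + t = {1}: they are closed under multiplication, and every
    t in 1 - 1 other than 0, -1 is one of them.  As t has finite order,
    t and -t cannot both be of this kind, so 1 - 1 lies in {0, 1, -1}; the rest
    of R is then determined according to whether 1 = -1. *)

Require Import Defs.
From HB Require Import structures.
From mathcomp Require Import all_boot all_algebra.
From mathcomp Require Import boolp classical_sets cardinality.

Import GRing.Theory.

Local Open Scope classical_set_scope.

Set Implicit Arguments.
Unset Strict Implicit.
Unset Printing Implicit Defensive.

(** * Arithmetic of hyperfields *)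

Section HyperfieldTheory.
Variable R : hyperfield.
Implicit Types a b c x y z t : R.

Let hg := hf_hypergroup (hyperfieldP R).

Lemma hmulA : associative (@hmul R). Proof. exact: hf_mulA (hyperfieldP R). Qed.
Lemma hmulC : commutative (@hmul R). Proof. exact: hf_mulC (hyperfieldP R). Qed.
Lemma hmul1l : left_id hone (@hmul R). Proof. exact: hf_mul1 (hyperfieldP R). Qed.
Lemma hmul1r : right_id hone (@hmul R).
Proof. by move=> x; rewrite hmulC hmul1l. Qed.
Lemma hmul0r x : hmul x hzero = hzero. Proof. exact: hf_mul0 (hyperfieldP R) x. Qed.
Lemma hmul0l x : hmul hzero x = hzero. Proof. by rewrite hmulC hmul0r. Qed.
Lemma hone_neq0 : (hone : R) <> hzero.
Proof. by move/esym; exact: hf_neq01 (hyperfieldP R). Qed.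
Lemma hmulV x : x <> hzero -> exists y, hmul x y = hone.
Proof. exact: hf_inv (hyperfieldP R) x. Qed.

Lemma hadd_ex x y : exists z, hadd x y z. Proof. exact: hadd_nonempty hg x y. Qed.
Lemma haddC x y : hadd x y = hadd y x. Proof. exact: hf_addC (hyperfieldP R) x y. Qed.
Lemma hadd0x x : hadd hzero x = [set x]. Proof. exact: hadd0l hg x. Qed.
Lemma haddx0 x : hadd x hzero = [set x]. Proof. exact: hadd0r hg x. Qed.
Lemma haddP0 x y : hadd x y hzero <-> y = hopp x. Proof. exact: hopp_r hg x y. Qed.
Lemma hadd_opp x : hadd x (hopp x) hzero. Proof. exact/haddP0. Qed.
Lemma haddNx x : hadd (hopp x) x hzero. Proof. by rewrite haddC; exact: hadd_opp. Qed.
Lemma setop_haddA a b c :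
  setop (@hadd R) [set a] (hadd b c) = setop (@hadd R) (hadd a b) [set c].
Proof. exact: haddA hg a b c. Qed.
Lemma himage_hadd a x y : [set hmul a z | z in hadd x y] = hadd (hmul a x) (hmul a y).
Proof. exact: hf_mulD (hyperfieldP R) a x y. Qed.

Lemma hoppK : involutive (@hopp R).
Proof. by move=> x; apply/esym/haddP0/haddNx. Qed.
Lemma hopp_inj : injective (@hopp R). Proof. exact: can_inj hoppK. Qed.
Lemma hopp0 : hopp hzero = hzero :> R.
Proof. by apply/esym/haddP0; rewrite hadd0x. Qed.

Lemma hadd_mul a x y z : hadd x y z -> hadd (hmul a x) (hmul a y) (hmul a z).
Proof. by move=> xyz; rewrite -himage_hadd; exists z. Qed.

Lemma hmulrN x y : hmul x (hopp y) = hopp (hmul x y).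
Proof. by apply/haddP0; rewrite -(hmul0r x); apply/hadd_mul/hadd_opp. Qed.
Lemma hmulNr x y : hmul (hopp x) y = hopp (hmul x y).
Proof. by rewrite hmulC hmulrN hmulC. Qed.

Lemma hmul_eq0 x y : hmul x y = hzero -> x = hzero \/ y = hzero.
Proof.
have [-> _|xn0 xy0] := EM (x = hzero); [by left | right].
by have [x' xx'] := hmulV xn0; rewrite -(hmul1l y) -xx' (hmulC x) -hmulA xy0 hmul0r.
Qed.

Lemma hadd_assoc a b c u z :
  hadd b c u -> hadd a u z -> exists2 v, hadd a b v & hadd v c z.
Proof. by move=> bcu auz; apply/setop1r; rewrite -setop_haddA; apply/setop1l; exists u. Qed.

Lemma hadd_assocV a b c v z :
  hadd a b v -> hadd v c z -> exists2 u, hadd b c u & hadd a u z.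
Proof. by move=> abv vcz; apply/setop1l; rewrite setop_haddA; apply/setop1r; exists v. Qed.

Lemma hadd_oppP x y z : hadd x y z <-> hadd (hopp x) (hopp y) (hopp z).
Proof. by rewrite (haddC (hopp x)); exact: hadd_rev hg z x y. Qed.

(** Since 0 lies in z - z, it lies in x + (y - z) by associativity. Hence y - z contains the
    opposite of x, and negating gives the claim. *)
Lemma hadd_move x y z : hadd x y z -> hadd z (hopp y) x.
Proof.
move=> xyz; have [v yzv /haddP0 vx] := hadd_assocV xyz (hadd_opp z).
by apply/hadd_oppP; rewrite hoppK haddC -vx.
Qed.

(** This property is known as stringency. The sum qx + qy - px - py contains qp - pq, hence 0. By
    double distributivity 0 is then a product of an element of q - p and an element of x + y, and
    one of these two factors vanishes. *)
Lemma doubly_distributive_stringent : doubly_distributive R ->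
  forall x y p q, y <> hopp x -> hadd x y p -> hadd x y q -> p = q.
Proof.
move=> dd x y p q yNx xyp xyq; apply: contrapT => pq.
have pqN : hadd (hmul q p) (hmul (hopp p) q) hzero.
  by rewrite hmulNr (hmulC p); exact: hadd_opp.
(* The sum is rebracketed into the left-nested form of [doubly_distributive]: v lies in qp - px, and
   0 lies in v - py. *)
have [v v1 v2] := hadd_assoc (hadd_mul (hopp p) xyq) pqN.
have : [set hmul u w | u in hadd q (hopp p) & w in hadd x y] hzero.
  rewrite dd; apply/setop1r; exists v => //; apply/setop1r.
  by exists (hmul q p) => //; exact: hadd_mul.
case=> u qpu [w xyw] /hmul_eq0[u0|w0].
  by apply/pq/hopp_inj; apply/haddP0; rewrite -u0.
by apply/yNx/haddP0; rewrite -w0.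
Qed.

(** * Powers and absorbed elements *)

Definition hexp t n := iter n (hmul t) hone.

Lemma hexpD t m n : hexp t (m + n) = hmul (hexp t m) (hexp t n).
Proof. by elim: m => [|m IH]; rewrite ?hmul1l // addSn /= IH hmulA. Qed.

Lemma hexp_neq0 t n : t <> hzero -> hexp t n <> hzero.
Proof. by move=> t0; elim: n => [|n IH]; [exact: hone_neq0 | case/hmul_eq0]. Qed.

Lemma finite_hexp_eq1 : finite_set [set: R] ->
  forall t, t <> hzero -> exists n, hexp t n.+1 = hone.
Proof.
move=> finR t t0.
have [i [j [ij tij]]] : exists i j, (i < j)%N /\ hexp t i = hexp t j.
  apply: contrapT => ninj.
  have inj : injective (hexp t).
    move=> i j tij; apply/eqP; apply: contrapT => /negP.
    by rewrite neq_ltn => /orP[] ij; apply: ninj; [exists i, j | exists j, i].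
  apply: infinite_nat; apply: (@sub_finite_set _ _ (hexp t @^-1` [set: R])) => //.
  by apply: finite_preimage => // x y _ _; exact: inj.
(* The period is j - i, written as a successor to keep it positive; an inverse s of the i-th power
   cancels that power. *)
exists (j - i).-1; rewrite prednK ?subn_gt0 //.
have [s ts] := hmulV (@hexp_neq0 t i t0).
move: tij; rewrite -(subnKC (ltnW ij)) hexpD => /(congr1 (hmul s)).
by rewrite hmulA (hmulC s) ts hmul1l addKn => <-.
Qed.

Definition absorbed t := hadd hone t = [set hone].

(** Scaling 1 + s = {1} by t gives t + ts = {t}. Then 1 + t + ts is {1} in one bracketing and 1 + ts
    in the other. *)
Lemma absorbedM s t : absorbed s -> absorbed t -> absorbed (hmul t s).
Proof.
rewrite /absorbed => As At; have ts : hadd t (hmul t s) = [set t].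
  by rewrite -{1}(hmul1r t) -himage_hadd As image_set1 hmul1r.
by have := setop_haddA hone t (hmul t s); rewrite ts At !setop11 At => <-.
Qed.

Lemma absorbed_exp t n : absorbed t -> absorbed (hexp t n.+1).
Proof.
by move=> At; elim: n => [|n IH]; [rewrite /hexp /= hmul1r | exact: absorbedM].
Qed.

(** Otherwise -1, being -t times a power of t, would be absorbed too, although 1 - 1 contains 0. *)
Lemma absorbed_oppN t n : hexp t n.+1 = hone -> absorbed t -> ~ absorbed (hopp t).
Proof.
move=> tn At ANt; suff : absorbed (hopp hone).
  by move=> A1; have := hadd_opp hone; rewrite A1 => /esym; exact: hone_neq0.
(* The exponent 0 is split off because only positive powers of t are known to be absorbed. *)
rewrite -tn -hmulNr; case: n {tn} => [|n]; first by rewrite hmul1r.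
by apply: absorbedM => //; exact: absorbed_exp.
Qed.

(** * Stringent hyperfields whose nonzero elements have finite order *)

Hypothesis stringent :
  forall x y p q, y <> hopp x -> hadd x y p -> hadd x y q -> p = q.
Hypothesis hexp_eq1 : forall t, t <> hzero -> exists n, hexp t n.+1 = hone.

(** Reversibility puts 1 into 1 + t, and stringency leaves no room for another element. *)
Lemma sub1_absorbed t : hadd hone (hopp hone) t -> t <> hopp hone -> absorbed t.
Proof.
move=> /hadd_move; rewrite hoppK haddC => t1 tN1.
by apply/predeqP => z; split=> [tz|->//]; exact: stringent tz t1.
Qed.

Lemma sub1_opp t : hadd hone (hopp hone) t -> hadd hone (hopp hone) (hopp t).
Proof. by move=> /hadd_oppP; rewrite hoppK haddC. Qed.

(** As 1 - 1 is closed under negation, any further t would be absorbed together with -t, which its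
    finite order forbids. *)
Lemma sub1_cases t :
  hadd hone (hopp hone) t -> [\/ t = hzero, t = hone | t = hopp hone].
Proof.
move=> Dt; apply: contrapT => Nt.
have [t0 t1 tN1] : [/\ t <> hzero, t <> hone & t <> hopp hone].
  by split=> tE; apply: Nt; [apply: Or31|apply: Or32|apply: Or33].
have [n tn] := hexp_eq1 t0.
apply: (absorbed_oppN tn); first exact: sub1_absorbed.
by apply: sub1_absorbed; [exact: sub1_opp | move/hopp_inj].
Qed.

(** Stringency leaves only the sums x - x = x(1 - 1), which are {0} here. *)
Lemma sub1_trivial x y : (forall t, hadd hone (hopp hone) t -> t = hzero) ->
  exists z, hadd x y = [set z].
Proof.
move=> D0; have [z xyz] := hadd_ex x y; exists z.
apply/predeqP => w; split=> [xyw|->//].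
have [yNx|] := EM (y = hopp x); last by move/stringent; exact.
suff D : forall u, hadd x y u -> u = hzero by rewrite (D _ xyz) (D _ xyw).
move=> u; have -> : y = hmul x (hopp hone) by rewrite hmulrN hmul1r.
by rewrite -{1}(hmul1r x) -himage_hadd => -[v /D0 -> <-]; rewrite hmul0r.
Qed.

(** The outcomes are, in order, the fields, [krasner] and [sign_hyperfield], each described by just
    what its isomorphism needs. *)
Lemma stringent_cases :
  [\/ forall x y, exists z, hadd x y = [set z],
      [/\ hadd hone hone = [set (hzero : R); hone] &
          forall x : R, x = hzero \/ x = hone] |
      [/\ hopp hone <> hone :> R,
          hadd hone hone = [set (hone : R)], hadd hone (hopp hone) = [set: R] &
          forall x : R, [\/ x = hzero, x = hone | x = hopp hone]]].
Proof.
have [D0|/existsNP[t /not_implyP[Dt t0]]] :=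
  EM (forall t, hadd hone (hopp hone) t -> t = hzero).
  by apply: Or31 => x y; exact: sub1_trivial.
have sub1P x : hadd hone x hone -> hadd hone (hopp hone) x.
  by move=> x1; apply: hadd_move; rewrite haddC.
(* The nonzero t in 1 - 1 is 1 or -1, and 1 - 1 is closed under negation. *)
have D1 : hadd hone (hopp hone) (hone : R).
  have [//|tE|tE] := sub1_cases Dt; rewrite tE in Dt => //.
  by have := sub1_opp Dt; rewrite hoppK.
have [N11|N11] := EM (hopp hone = hone :> R).
  apply: Or32; rewrite N11 in sub1P D1.
  have D01 x : hadd hone hone x -> x = hzero \/ x = hone.
    by rewrite -{2}N11 => /sub1_cases[]; rewrite ?N11; [left|right|right].
  split.
    apply/predeqP => x; split; first by move/D01.
    by case=> -> //; rewrite -{2}N11; exact: hadd_opp.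
  move=> x; apply: contrapT => /not_orP[x0 x1].
  have [y xy] := hadd_ex hone x.
  have D : hadd hone hone (hzero : R) by rewrite -{2}N11; exact: hadd_opp.
  have [y1|y1] := EM (y = hone); first by rewrite y1 in xy; have /D01[] := sub1P _ xy.
  have xN1 : x <> hopp hone by rewrite N11.
  have yN1 : y <> hopp hone by rewrite N11.
  (* Here 1 + x = {y}. Rebracketing (1 + 1) + x, with first 0 and then 1 taken from 1 + 1, puts x
     and y into 1 + y, so x = y by stringency. *)
  have [u ux u1] : exists2 u, hadd hone x u & hadd hone u x.
    by apply: hadd_assocV D _; rewrite hadd0x.
  have [v vx v1] := hadd_assocV D1 xy.
  rewrite (stringent xN1 ux xy) in u1; rewrite (stringent xN1 vx xy) in v1.
  rewrite (stringent yN1 v1 u1) in xy.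
  (* Now x lies in 1 + x, so 1 lies in x - x. Dividing by x puts its inverse into 1 - 1, which
     forces x = 1. *)
  have [x' xx'] := hmulV x0.
  move: (hadd_mul x' (hadd_move xy)).
  rewrite hmulrN (hmulC x') xx' hmul1r N11 => /D01[] x'E; move: xx'; rewrite x'E.
    by rewrite hmul0r => /esym; exact: hone_neq0.
  by rewrite hmul1r.
apply: Or33.
have A1 : hadd hone hone = [set (hone : R)] by apply: sub1_absorbed => //; exact: nesym.
have all x : [\/ x = hzero, x = hone | x = hopp hone].
  apply: contrapT => Nx.
  have [x0 x1 xN1] : [/\ x <> hzero, x <> hone & x <> hopp hone].
    by split=> xE; apply: Nx; [apply: Or31|apply: Or32|apply: Or33].
  have [y xy] := hadd_ex hone x.
  have y0 : y <> hzero by move=> yE; rewrite yE in xy; exact/xN1/haddP0.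
  (* If -1 were in 1 + x, then 0 would lie in 1 + (1 + x) = (1 + 1) + x = 1 + x, forcing x = -1. *)
  have yN1 : y <> hopp hone.
    move=> yE; rewrite yE in xy.
    have [v] := hadd_assoc xy (hadd_opp hone).
    by rewrite A1 => /= -> /haddP0.
  (* From 1 + x = (1 + 1) + x and stringency, y lies in 1 + y. As before the inverse of y lies in 1
     - 1, so y = 1, and then x itself lies in 1 - 1. *)
  have [u ux u1] : exists2 u, hadd hone x u & hadd hone u y.
    by apply: hadd_assocV xy; rewrite A1.
  rewrite (stringent xN1 ux xy) in u1.
  have [y' yy'] := hmulV y0.
  move: (hadd_mul y' (hadd_move u1)).
  rewrite hmulrN (hmulC y') yy' hmul1r => /sub1_cases[] y'E; move: yy'; rewrite y'E.
  - by rewrite hmul0r => /esym; exact: hone_neq0.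
  - rewrite hmul1r => yE; rewrite yE in xy.
    by have /sub1_cases[] := sub1P _ xy.
  - by rewrite hmulrN hmul1r => yE; apply: yN1; rewrite -yE hoppK.
split=> //; apply/predeqP => x; split=> // _.
by case: (all x) => ->; [exact: hadd_opp | | exact: sub1_opp].
Qed.

End HyperfieldTheory.

(** * Transport along isomorphisms *)

(** The map starts from the model [S], where it can be defined by cases on constructors, and
    hyperaddition is compared elementwise. *)
Lemma hf_isomorphic_inv (R S : hyperfield) (g : S -> R) :
  bijective g -> g hzero = hzero -> g hone = hone ->
  {morph g : x y / hmul x y >-> hmul x y} ->
  (forall x y z, hadd (g x) (g y) (g z) <-> hadd x y z) ->
  hf_isomorphic R S.
Proof.
move=> [f gK fK] g0 g1 gM gD; exists f; split.
- by exists g.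
- by rewrite -g0 gK.
- by rewrite -g1 gK.
- by move=> x y; apply: (can_inj gK); rewrite gM !fK.
- move=> x y; apply/predeqP => z; split=> [[u xyu <-]|xyz].
    by apply/gD; rewrite !fK.
  by exists (g z); rewrite ?gK // -[x]fK -[y]fK; apply/gD.
Qed.

Lemma hf_isomorphic_finite (R S : hyperfield) :
  hf_isomorphic R S -> finite_set [set: S] -> finite_set [set: R].
Proof.
case=> f [[g fK gK] _ _ _ _] /(finite_image g); apply: sub_finite_set => x _.
by exists (f x).
Qed.

Lemma hf_isomorphic_dd (R S : hyperfield) :
  hf_isomorphic R S -> doubly_distributive S -> doubly_distributive R.
Proof.
case=> f [[g fK gK] _ _ fM fD] dd a b c d.
have f_setop A B : f @` setop (@hadd R) A B = setop (@hadd S) (f @` A) (f @` B).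
  apply/predeqP => z; split.
    move=> [w [x Ax [y By xyw]] <-].
    exists (f x); first by exists x.
    by exists (f y); [exists y | rewrite -fD; exists w].
  move=> [_ [x Ax <-] [_ [y By <-]]]; rewrite -fD => -[w xyw <-].
  by exists w => //; exists x => //; exists y.
have f_img A B : f @` [set hmul x y | x in A & y in B] =
    [set hmul x y | x in f @` A & y in f @` B].
  apply/predeqP => z; split.
    move=> [_ [x Ax [y By <-]] <-]; rewrite fM.
    by exists (f x); [exists x | exists (f y) => //; exists y].
  move=> [_ [x Ax <-] [_ [y By <-] <-]]; rewrite -fM.
  by exists (hmul x y) => //; exists x => //; exists y.
have f_img_inj (A B : set R) : f @` A = f @` B -> A = B.
  by move=> AB; apply/predeqP => x; rewrite -!(image_inj (can_inj fK)) AB.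
by apply: f_img_inj; rewrite f_img !f_setop !image_set1 !fD !fM dd.
Qed.

(** * Double distributivity and finiteness of the models *)

Lemma field_dd (F : fieldType) : doubly_distributive (field_hyperfield F).
Proof.
have E (a b c d : F) : (a * c + a * d + b * c + b * d = (a + b) * (c + d))%R.
  by rewrite mulrDl !mulrDr addrA.
move=> a b c d; rewrite /= /field_add !setop11 E.
apply/predeqP => z; split; first by move=> [_ -> [_ -> <-]].
by move=> ->; exists (a + b : F)%R => //; exists (c + d : F)%R.
Qed.

(* The equation z = x y is written z \in 0 + x y, so that no decidable equality
   on R is needed. *)
Lemma dd_decide (R : hyperfield) (addb : R -> R -> R -> bool)
    (exb : (R -> bool) -> bool) :
  (forall x y z, hadd x y z <-> addb x y z) ->
  (forall P : R -> bool, (exists x, P x) <-> exb P) ->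
  (forall a b c d z,
    exb (fun x => exb (fun y =>
      [&& addb a b x, addb c d y & addb hzero (hmul x y) z])) =
    exb (fun u => exb (fun v =>
      [&& addb (hmul a c) (hmul a d) u, addb u (hmul b c) v
        & addb v (hmul b d) z]))) ->
  doubly_distributive R.
Proof.
move=> addP exP E a b c d; apply/predeqP => z; rewrite setop1r.
have {}E := E a b c d z; split.
  move=> [x abx [y cdy xyz]].
  have /exP[u /exP[v /and3P[/addP u1 /addP v1 /addP z1]]] :
      exb (fun u => exb (fun v =>
        [&& addb (hmul a c) (hmul a d) u, addb u (hmul b c) v
          & addb v (hmul b d) z])).
    rewrite -E; apply/exP; exists x; apply/exP; exists y.
    by apply/and3P; split; apply/addP => //; rewrite hadd0x.
  by exists v => //; apply/setop1r; exists u.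
move=> [v /setop1r[u u1 v1] z1].
have /exP[x /exP[y /and3P[/addP abx /addP cdy /addP]]] :
    exb (fun x => exb (fun y =>
      [&& addb a b x, addb c d y & addb hzero (hmul x y) z])).
  rewrite E; apply/exP; exists u; apply/exP; exists v.
  by apply/and3P; split; apply/addP.
by rewrite hadd0x => ->; exists x => //; exists y.
Qed.

Lemma ex_boolP (P : bool -> bool) : (exists b, P b) <-> P false || P true.
Proof. by split=> [[[] ->]|/orP[]]; rewrite ?orbT //; [exists false | exists true]. Qed.

Lemma krasner_dd : doubly_distributive krasner.
Proof.
by apply: (@dd_decide krasner _ _ krasner_addP ex_boolP) => -[] [] [] [] [].
Qed.

Lemma sign_dd : doubly_distributive sign_hyperfield.
Proof.
by apply: (@dd_decide sign_hyperfield _ _ sign_addP ex_sign) => -[] [] [] [] [].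
Qed.

Lemma krasner_finite : finite_set [set: krasner].
Proof. exact: (@finite_finset bool). Qed.

Lemma sign_finite : finite_set [set: sign_hyperfield].
Proof.
have -> : [set: sign_hyperfield] = [set SZero] `|` [set SPos] `|` [set SNeg].
  by apply/predeqP => -[]; split=> // _; [left; left | left; right | right].
by rewrite !finite_setU; do !split; exact: finite_set1.
Qed.

(** * Recognition of the Krasner and sign hyperfields *)

Section SignKrasner.
Variable R : hyperfield.

Lemma krasner_iso : hadd hone hone = [set (hzero : R); hone] ->
  (forall x : R, x = hzero \/ x = hone) -> hf_isomorphic R krasner.
Proof.
move=> D all; pose g (b : krasner) : R := if b then hone else hzero.
have gT (u : R) : exists b, g b = u by case: (all u) => ->; [exists false | exists true].
have inj : injective g by move=> [] [] //= => [/hone_neq0|/esym/hone_neq0].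
have [f fE] := choice gT.
apply: (@hf_isomorphic_inv R krasner g) => //.
- by exists f => // x; apply: inj; rewrite fE.
- by move=> [] [] /=; rewrite ?hmul0l ?hmul1l.
- move=> x y z; case: x y => [] [] /=; rewrite ?D ?hadd0x ?haddx0 /=.
  + by split=> // _; exact: all.
  + by split=> [e|->//]; apply: inj; exact: e.
  + by split=> [e|->//]; apply: inj; exact: e.
  + by split=> [e|->//]; apply: inj; exact: e.
Qed.

Lemma sign_iso : hopp hone <> hone :> R -> hadd hone hone = [set (hone : R)] ->
  hadd hone (hopp hone) = [set: R] ->
  (forall x : R, [\/ x = hzero, x = hone | x = hopp hone]) ->
  hf_isomorphic R sign_hyperfield.
Proof.
move=> N1 D DN all.
pose g (s : sign_hyperfield) : R :=
  match s with SZero => hzero | SPos => hone | SNeg => hopp hone end.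
have gT (u : R) : exists s, g s = u.
  by case: (all u) => ->; [exists SZero | exists SPos | exists SNeg].
have N0 : hopp hone <> hzero :> R.
  by rewrite -(hopp0 R) => /hopp_inj/hone_neq0.
have inj : injective g.
  by move=> [] [] //= => [/esym/hone_neq0|/esym/N0|/hone_neq0|/esym/N1].
have DNN : hadd (hopp hone) (hopp hone) = [set (hopp hone : R)].
  have := himage_hadd (hopp (hone : R)) hone hone.
  by rewrite D image_set1 hmul1r => <-.
have [f fE] := choice gT.
apply: (@hf_isomorphic_inv R sign_hyperfield g) => //.
- by exists f => // x; apply: inj; rewrite fE.
- by move=> [] [] /=; rewrite ?hmul0l ?hmul1l ?hmul0r ?hmul1r // hmulNr hmul1l hoppK.
- move=> x y z; case: x y => [] [] /=;
    rewrite ?D ?DN ?DNN ?(haddC (hopp hone)) ?DN ?hadd0x ?haddx0 //=;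
    by split=> [e|->//]; apply: inj; exact: e.
Qed.

End SignKrasner.

(** * Single-valued addition and finite fields *)

(** A left-invertible map to a [finType] is what [can_type] needs to make a bare type finite. *)
Lemma finite_set_can (T : Type) : finite_set [set: T] ->
  exists (F : finType) (f : T -> F) (g : F -> T), cancel f g.
Proof.
elim/Pchoice: T => T /finite_seqP[s sE].
have sT x : x \in s by have : [set: T] x by []; rewrite sE.
by exists (seq_sub s), (fun x => SeqSub (sT x)), val.
Qed.

Section SingleValued.
Variables (R : hyperfield) (F : finType) (f : R -> F) (g : F -> R).
Variables (add : R -> R -> R) (inv : R -> R).
Hypothesis fK : cancel f g.
Hypothesis addE : forall x y, hadd x y = [set add x y].
Hypothesis invE : forall x, x <> hzero -> hmul x (inv x) = hone.
Hypothesis inv0 : inv hzero = hzero.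

(* A copy of R whose phantom arguments let its instances be inferred. *)
Definition carrier of cancel f g & (forall x y, hadd x y = [set add x y])
  & (forall x, x <> hzero -> hmul x (inv x) = hone) & inv hzero = hzero : Type := R.
Local Notation K := (carrier fK addE invE inv0).

HB.instance Definition _ := Finite.copy K (can_type fK).

Let addP x y z : hadd x y z <-> z = add x y. Proof. by rewrite addE. Qed.

Let add_assoc : associative add.
Proof.
move=> x y z; have := setop_haddA x y z; rewrite !addE !setop11 !addE => E.
by have : [set add x (add y z)] (add x (add y z)) by []; rewrite E.
Qed.

Let add_comm : commutative add.
Proof. by move=> x y; apply/addP; rewrite haddC addE. Qed.

Let add_0l : left_id hzero add.
Proof. by move=> x; apply/esym/addP; rewrite hadd0x. Qed.

Let add_Nl : left_inverse hzero (@hopp R) add.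
Proof. by move=> x; apply/esym/addP; exact: haddNx. Qed.

Let mul_addl : left_distributive (@hmul R) add.
Proof.
by move=> x y z; apply/addP; rewrite !(hmulC _ z); apply/hadd_mul/addP.
Qed.

HB.instance Definition _ := GRing.isZmodule.Build K add_assoc add_comm add_0l add_Nl.

Let one_neq0 : (hone : K) != 0%R. Proof. by apply/eqP; exact: hone_neq0. Qed.

HB.instance Definition _ := GRing.Zmodule_isComNzRing.Build K
  (@hmulA R) (@hmulC R) (@hmul1l R) mul_addl one_neq0.

Let mulVf (x : K) : (x != 0 -> (inv x : K) * x = 1)%R.
Proof. by move/eqP=> x0; rewrite mulrC; exact: invE. Qed.

HB.instance Definition _ := GRing.ComNzRing_isField.Build K mulVf inv0.

Lemma carrier_iso : hf_isomorphic R (field_hyperfield K).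
Proof.
by apply: (@hf_isomorphic_inv R (field_hyperfield K) id) => //; exists id.
Qed.

End SingleValued.

Lemma single_valued_iso (R : hyperfield) : finite_set [set: R] ->
  (forall x y : R, exists z, hadd x y = [set z]) ->
  exists F : finFieldType, hf_isomorphic R (field_hyperfield F).
Proof.
move=> /finite_set_can[F [f [g fK]]] sv.
have [add addE] := choice (fun p : R * R => sv p.1 p.2).
(* The inverse of 0 is fixed to be 0, as the field structure demands. *)
have inv_ex (x : R) : exists y : R,
    (x <> hzero -> hmul x y = hone) /\ (x = hzero -> y = hzero).
  have [->|x0] := EM (x = hzero); first by exists hzero.
  by have [y xy] := hmulV x0; exists y.
have [inv invP] := choice inv_ex.
have addE' x y : hadd x y = [set add (x, y)] by exact: addE (x, y).
exists (carrier (add := fun x y => add (x, y)) fK addE' (fun x => (invP x).1) ((invP hzero).2 erefl)).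
exact: carrier_iso.
Qed.

Theorem mainTheorem4 (R : hyperfield) :
  (finite_set [set: R] /\ doubly_distributive R) <->
  [\/ hf_isomorphic R krasner,
      hf_isomorphic R sign_hyperfield |
      exists F : finFieldType, hf_isomorphic R (field_hyperfield F)].
Proof.
split=> [[finR dd]|].
  have [sv|[D all]|[N1 D DN all]] :=
    stringent_cases (doubly_distributive_stringent dd) (finite_hexp_eq1 finR).
  - by apply: Or33; exact: single_valued_iso.
  - by apply: Or31; exact: krasner_iso.
  - by apply: Or32; exact: sign_iso.
case=> [iso|iso|[F iso]]; split.
- exact: hf_isomorphic_finite iso krasner_finite.
- exact: hf_isomorphic_dd iso krasner_dd.
- exact: hf_isomorphic_finite iso sign_finite.
- exact: hf_isomorphic_dd iso sign_dd.
- exact: hf_isomorphic_finite iso (@finite_finset F _).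
- exact: hf_isomorphic_dd iso (@field_dd F).
Qed.
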